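(* Let $(X_n)_{n\ge 0}$ be a Galton--Watson process with immigration such that $X_0$ is regularly varying with index $\beta \in [0,\infty)$, $\mathbb{P}(\xi = 0) < 1$ and there exists $r \in (\max(1,\beta),\infty)$ with $\mathbb{E}(\xi^r) < \infty$ and $\mathbb{E}(\varepsilon^r) < \infty$. Then for each $n \in \mathbb{N}$, we have $$\mathbb{P}(X_n > x) \sim m_\xi^{n\beta}\, \mathbb{P}(X_0 > x) \qquad \text{as } x \to \infty,$$ and hence $X_n$ is also regularly varying with index $\beta$.
   Context: A Galton--Watson process with immigration is a stochastic process $(X_n)_{n\ge 0}$ given by $X_n = \sum_{i=1}^{X_{n-1}} \xi_{n,i} + \varepsilon_n$, $n \ge 1$, where $\{X_0, \xi_{n,i}, \varepsilon_n : n,i \ge 1\}$ are independent non-negative integer-valued random variables, the $\xi_{n,i}$ ($n,i\ge1$) are identically distributed, the $\varepsilon_n$ ($n\ge 1$) are identically distributed, and $\sum_{i=1}^0 := 0$. Here $\xi$ and $\varepsilon$ denote random variables with the distribution of $\xi_{1,1}$ and $\varepsilon_1$, respectively, and $m_\xi := \mathbb{E}(\xi)$. $\mathbb{N} = \{1,2,\ldots\}$. A non-negative random variable $X$ is regularly varying with index $\alpha \in [0,\infty)$ if $\mathbb{P}(X > x) > 0$ for all $x > 0$ and $\lim_{x\to\infty} \mathbb{P}(X > qx)/\mathbb{P}(X > x) = q^{-\alpha}$ for all $q > 0$. $f(x) \sim g(x)$ as $x\to\infty$ means $\lim_{x\to\infty} f(x)/g(x) = 1$. *)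

(* Defs.v *)
From HB Require Import structures.
From mathcomp Require Import all_boot all_order all_algebra.
From mathcomp Require Import finmap.
From mathcomp Require Import all_classical all_reals all_analysis.

Set Implicit Arguments.
Unset Strict Implicit.
Unset Printing Implicit Defensive.

Import Order.TTheory GRing.Theory Num.Theory.
Import numFieldNormedType.Exports.

Local Open Scope classical_set_scope.
Local Open Scope ring_scope.

Section random_variables.
Context {d : measure_display} {T : measurableType d} {R : realType}.
Variable P : probability T R.

Definition natr_rv_fun (X : {RV P >-> nat}) (w : T) : R := (X w)%:R.

Lemma measurable_natr_rv (X : {RV P >-> nat}) :
  measurable_fun setT (natr_rv_fun X).
Proof.
by apply: (@measurableT_comp _ _ _ _ _ _ (fun k : nat => k%:R : R) _ X).
Qed.

HB.instance Definition _ (X : {RV P >-> nat}) :=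
  isMeasurableFun.Build _ _ _ _ (natr_rv_fun X) (measurable_natr_rv X).

Definition natr_rv (X : {RV P >-> nat}) : {RV P >-> R} := natr_rv_fun X.

Definition mutually_independent {d'} {T' : measurableType d'} {I : choiceType}
    (Y : I -> {RV P >-> T'}) : Prop :=
  forall (J : {fset I}) (A : I -> set T'),
    (forall j, measurable (A j)) ->
    P (\bigcap_(j in [set` J]) Y j @^-1` A j) =
      (\prod_(j <- J) P (Y j @^-1` A j))%E.

Definition identically_distributed {d'} {T' : measurableType d'}
    (Y Z : {RV P >-> T'}) : Prop :=
  forall A : set T', measurable A -> distribution P Y A = distribution P Z A.

Definition tail (X : {RV P >-> R}) (x : R) : R := fine (ccdf X x).

Definition regularly_varying (X : {RV P >-> R}) (alpha : R) : Prop :=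
  [/\ forall w, 0 <= X w,
      forall x, 0 < x -> 0 < tail X x
    & forall q, 0 < q ->
        tail X (q * x) / tail X x @[x --> +oo] --> q `^ (- alpha)].

End random_variables.

Definition asymp_equiv {R : realType} (f g : R -> R) : Prop :=
  f x / g x @[x --> +oo] --> (1 : R).

                                                                    
                                                                          
                       
Definition gwi_index : Type := (unit + (nat * nat + nat))%type.

Section galton_watson.
Context {d : measure_display} {T : measurableType d} {R : realType}.
Variable P : probability T R.

Definition gwi_family (X0 : {RV P >-> nat}) (xi : nat -> nat -> {RV P >-> nat})
    (eps : nat -> {RV P >-> nat}) (k : gwi_index) : {RV P >-> nat} :=
  match k with
  | inl _ => X0
  | inr (inl (n, i)) => xi n.+1 i.+1
  | inr (inr n) => eps n.+1
  end.

Record galton_watson_immigration (X : nat -> {RV P >-> nat})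
    (xi : nat -> nat -> {RV P >-> nat}) (eps : nat -> {RV P >-> nat}) : Prop := {
  gwi_indep : mutually_independent (gwi_family (X 0%N) xi eps);
  gwi_xi_id : forall n i, (1 <= n)%N -> (1 <= i)%N ->
    identically_distributed (xi n i) (xi 1%N 1%N);
  gwi_eps_id : forall n, (1 <= n)%N ->
    identically_distributed (eps n) (eps 1%N);
  gwi_rec : forall n w, (1 <= n)%N ->
    X n w = (\sum_(1 <= i < (X n.-1 w).+1) xi n i w + eps n w)%N
}.

End galton_watson.

(* Main.v *)
Require Import Defs.
From mathcomp Require Import all_boot all_order all_algebra.
From mathcomp Require Import finmap zify ring lra.
From mathcomp Require Import all_classical all_reals all_analysis.
From mathcomp Require Import measurable_realfun.

Set Implicit Arguments.
Unset Strict Implicit.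
Unset Printing Implicit Defensive.

Import Order.TTheory GRing.Theory Num.Theory.
Import numFieldNormedType.Exports.

Local Open Scope classical_set_scope.
Local Open Scope ring_scope.

(** One generation replaces the population X by S = xi_1 + ... + xi_X + eps, with
    the xi_i and eps as in the process, so it suffices to show that if X is regularly
    varying with index beta and is independent of the xi_i, then
    P(S > x) ~ m^beta P(X > x), with m the mean of xi; the theorem follows by
    multiplying such equivalences over the generations, and regular variation is
    inherited along the way because it only depends on the tail up to an
    asymptotically constant factor ([regularly_varying_equiv]).

    The equivalence expresses that S > x happens essentially only when X > x / m:
    a sum of k copies of xi is about k m, and the moment of order
    r > max(1, beta) makes all other causes negligible. It is enough to compare
    P(S > x) with P(X > c x) for each c on either side of 1 / m and then to let
    c tend to 1 / m, since P(X > c x) / P(X > x) tends to c^(-beta)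
    ([regular_variation_ratio_cvg]).

    If c m < 1 ([compound_tail_le]), then S > x forces one of four events:
    X > c x; eps is a positive fraction of x; some xi_i with i <= min(X, c x)
    exceeds a level N; or the sum of the first c x variables min(xi_i, N)
    exceeds its mean by a positive fraction of x. With N about x^theta and
    theta < 1, the last event has probability at most exp (- b x^(1 - theta)) by a
    Chernoff bound. The third one costs
    (sum_(i < c x) P(X > i)) P(xi > N), where only the independence of X from
    each single xi_i is used. Its first factor is at most C x^q P(X > x) for
    every q > max(1, beta) ([regular_variation_sum_le], a Potter-type bound), while
    P(xi > N) is at most of order x^(- theta r); choosing theta r > q makes the
    product negligible. If c m > 1 ([compound_tail_ge]), then X > c x makes S > x
    happen, unless a sum of more than c x variables min(xi_i, N) is at most x;
    for a fixed large N this is exponentially unlikely, and by independence it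
    remains so on the event X > c x.

    Independence is handled through [indep_event]: an event is called
    independent of the variables Y_i, i in D, when it is independent of every
    finite cylinder over D. Splitting along the values of a discrete variable
    ([indep_event_partition]) transports this property from X_n to X_(n+1), and
    yields the Chernoff bound on such an event without any integral of a
    product ([indep_sum_chernoff]). *)

(** * Powers and exponentials at infinity *)

Section powers_at_infinity.
Context {R : realType}.
Implicit Types a b q x : R.

Lemma ltr_powR a x y : 1 < a -> x < y -> a `^ x < a `^ y.
Proof.
move=> a1 xy; have a0 : a != 0 by rewrite lt0r_neq0// (lt_trans _ a1).
by rewrite /powR (negbTE a0) ltr_expR ltr_pM2r// ln_gt0.
Qed.

Lemma cvg_powR_y a : 0 < a -> x `^ a @[x --> +oo] --> +oo.
Proof.
move=> a0; apply/cvgryPge => A; near=> x.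
have M1 : 0 <= Num.max A 1 by rewrite le_max ler01 orbT.
apply: (@le_trans _ _ (Num.max A 1)); first by rewrite le_max lexx.
rewrite -[leLHS]powRr1// -(mulVf (lt0r_neq0 a0)) powRrM.
have xA : Num.max A 1 `^ a^-1 <= x by near: x; apply: nbhs_pinfty_ge; exact: num_real.
by apply: ge0_ler_powR => //; rewrite ?nnegrE ?(le_trans _ xA) ?powR_ge0// ltW.
Unshelve. all: by end_near. Qed.

Lemma cvg_powR_0 a : 0 < a -> x `^ (- a) @[x --> +oo] --> (0 : R).
Proof.
move=> a0; under eq_fun do rewrite powRN.
apply/gtr0_cvgV0; last exact: cvg_powR_y.
by near=> x; apply: powR_gt0.
Unshelve. all: by end_near. Qed.

(** The exponential beats any power: expR u is at least u ^ n.+1 / n.+1`!, and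
    n is taken with a * n.+1 > q. *)
Lemma cvg_powR_expR q a b : 0 < a -> 0 < b ->
  x `^ q * expR (- (b * x `^ a)) @[x --> +oo] --> (0 : R).
Proof.
move=> a0 b0; pose n := Num.truncn (q / a).
pose C := (n.+1)`!%:R / b ^+ n.+1.
apply: (@squeeze_cvgr _ _ _ _ (fun=> 0) (fun x => C * x `^ (- (a * n.+1%:R - q)))).
- near=> x.
  have x0 : 0 < x by [].
  have u0 : 0 < b * x `^ a by rewrite mulr_gt0// powR_gt0.
  rewrite mulr_ge0 ?powR_ge0 ?expR_ge0//=.
  rewrite opprB powRD ?(lt0r_neq0 x0) ?implybT// mulrCA.
  apply: ler_wpM2l; first exact: powR_ge0.
  rewrite expRN powRN powRrM powR_mulrn ?powR_ge0// /C -mulrA -invfM -exprMn.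
  rewrite -[leLHS]div1r ler_pdivrMr ?expR_gt0// mulrAC ler_pdivlMr ?exprn_gt0// mul1r.
  rewrite [leRHS]mulrC -ler_pdivrMr ?ltr0n ?fact_gt0//.
  by apply: (le_trans _ (expR_ge1Dxn n (ltW u0))); rewrite lerDr.
- exact: cvg_cst.
- rewrite -[X in _ --> X](mulr0 C); apply: cvgMr; apply: cvg_powR_0.
  by rewrite subr_gt0 -ltr_pdivrMl// mulrC truncnS_gt.
Unshelve. all: by end_near. Qed.

Lemma cvg_mul_y (c : R) : 0 < c -> c * x @[x --> +oo] --> +oo.
Proof. by move=> c0; apply: gt0_cvgMry => //; exact: cvg_id. Qed.

Lemma cvg_truncn_powR_y a : 0 < a ->
  (Num.truncn (x `^ a))%:R @[x --> +oo] --> (+oo : set_system R).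
Proof.
move=> a0; apply: (@ger_cvgy _ _ _ _ (fun x => x `^ a + (- 1))).
  by near=> x; have := truncnS_gt (x `^ a); rewrite -natr1; lra.
apply: (cvg_comp _ (fun y : R => y + -1) (cvg_powR_y a0)).
exact: cvg_addrr.
Unshelve. all: by end_near. Qed.

Lemma cvg_powR1 b : t `^ b @[t --> (1 : R)] --> (1 : R).
Proof.
have : {for (1:R), continuous (fun t : R => t `^ b)}.
  apply: differentiable_continuous; apply/derivable1_diffP.
  by apply: derivable_powR; rewrite in_itv/= ltr01.
by rewrite /prop_for /continuous_at powR1.
Qed.

End powers_at_infinity.

(** * Regularly varying functions *)

Section regular_variation.
Context {R : realType} (F : R -> R) (beta : R).
Hypothesis Fmono : forall x y, x <= y -> F y <= F x.
Hypothesis Fpos : forall x, 0 < x -> 0 < F x.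
Hypothesis Frv : forall q, 0 < q -> F (q * x) / F x @[x --> +oo] --> q `^ (- beta).

(** Potter-type bound. Let W K be the ratio (1 + \sum_(i < K) F i) / F K. Doubling
    K multiplies 1 / F by at most 2 `^ q, as beta < q, and adds at most K * F K to
    the sum; since also q > 1, the function W K + A * K is multiplied by at most
    2 `^ q for a suitable A, hence grows at most like K `^ q. *)
Lemma regular_variation_sum_le q : 1 < q -> beta < q ->
  exists2 C : R, 0 < C & forall K, (0 < K)%N ->
    1 + \sum_(i < K) F i%:R <= C * K%:R `^ q * F K%:R.
Proof.
move=> q1 bq.
pose G K := \sum_(i < K) F i%:R.
have p0 : 0 < 2 `^ q :> R by rewrite powR_gt0.
have p2 : 2 < 2 `^ q :> R.
  by rewrite -[ltLHS]powRr1//; apply: ltr_powR => //; rewrite ltr1n.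
have Fi i : 0 <= F i%:R.
  by apply: le_trans (Fmono (_ : i%:R <= i.+1%:R)); rewrite ?ler_nat// ltW// Fpos.
have Gmono K L : (K <= L)%N -> G K <= G L.
  move=> KL; rewrite /G -!(big_mkord xpredT (fun i => F i%:R)).
  by rewrite (big_cat_nat (leq0n _) KL)//= lerDl sumr_ge0.
have G0 K : 0 <= G K by rewrite sumr_ge0.
(* doubling the argument divides F by at most 2^q, as beta < q *)
have [K0 K00 hK0] : exists2 K0, (0 < K0)%N & forall K, (K0 <= K)%N ->
    F K%:R <= 2 `^ q * F (2 * K)%:R.
  have : \forall x \near +oo, 2 `^ (- q) < F (2 * x) / F x.
    apply: (cvgr_gt _ (Frv _)) => //.
    by apply: ltr_powR; rewrite ?ltr1n// ltrN2.
  move=> [B [_ hB]]; exists (Num.truncn `|B|).+1 => // K KB.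
  have KR0 : 0 < K%:R :> R by rewrite ltr0n (leq_trans _ KB).
  have /hB : B < K%:R.
    apply: (le_lt_trans (ler_norm B)); apply: (lt_le_trans (truncnS_gt _)).
    by rewrite ler_nat.
  rewrite ltr_pdivlMr ?Fpos// powRN -natrM.
  by rewrite mulrC ltr_pdivrMr// => /ltW; rewrite mulrC.
pose A := 2 `^ q / (2 `^ q - 2).
have A0 : 0 <= A by apply: divr_ge0; rewrite ?subr_ge0 ltW.
pose V K := (1 + G K) / F K%:R + A * K%:R.
have Vmono K L : (0 < K)%N -> (K <= L)%N -> V K <= V L.
  move=> K0' KL; have L0' : (0 < L)%N by exact: leq_trans KL.
  rewrite /V; apply: lerD; last by rewrite ler_wpM2l// ler_nat.
  apply: ler_pM; rewrite ?addr_ge0 ?invr_ge0//; first by rewrite lerD2l Gmono.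
  by rewrite lef_pV2 ?posrE ?Fpos ?ltr0n// Fmono// ler_nat.
have Vdouble K : (K0 <= K)%N -> V (2 * K)%N <= 2 `^ q * V K.
  move=> K0K; have KK : (0 < K)%N by exact: leq_trans K0K.
  have FK : 0 < F K%:R by rewrite Fpos// ltr0n.
  have F2K : 0 < F (2 * K)%:R by rewrite Fpos// ltr0n muln_gt0.
  have GG : G (2 * K)%N <= G K + K%:R * F K%:R.
    rewrite /G -!(big_mkord xpredT (fun i => F i%:R)) (@big_cat_nat _ _ _ K)//=; last by lia.
    rewrite lerD2l mulr_natl (_ : F K%:R *+ K = \sum_(K <= i < 2 * K) F K%:R); last first.
      by rewrite sumr_const_nat; congr (_ *+ _); lia.
    rewrite !big_nat; apply: ler_sum => i /andP[Ki _].
    by rewrite Fmono// ler_nat.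
  have e1 : (1 + G (2 * K)%N) / F (2 * K)%:R <= 2 `^ q * ((1 + G K) / F K%:R + K%:R).
    rewrite ler_pdivrMr// mulrAC.
    apply: (@le_trans _ _ (F K%:R * ((1 + G K) / F K%:R + K%:R))).
      rewrite mulrDr mulrCA divff ?mulr1 ?lt0r_neq0//.
      by rewrite -addrA lerD2l mulrC.
    by apply: ler_wpM2r; [rewrite addr_ge0// divr_ge0 ?addr_ge0// ltW|exact: hK0].
  (* the constant A is chosen so that 2^q K + 2 A K = 2^q A K *)
  have e2 : 2 `^ q * K%:R + A * (2 * K)%:R = 2 `^ q * (A * K%:R).
    rewrite natrM /A; field; apply: lt0r_neq0; lra.
  by rewrite /V; move: e1; rewrite !mulrDr -e2; lra.
have Viter j : V (2 ^ j * K0)%N <= (2 `^ q) ^+ j * V K0.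
  elim: j => [|j IHj]; first by rewrite expn0 mul1n expr0 mul1r.
  rewrite expnS -mulnA exprS -mulrA.
  apply: (le_trans (Vdouble _ _)); first by rewrite leq_pmull// expn_gt0.
  by apply: ler_wpM2l => //; exact: ltW.
have V0 : 0 < V K0.
  rewrite /V ltr_wpDr//; first by rewrite mulr_ge0.
  by apply: divr_gt0; rewrite ?Fpos ?ltr0n// ltr_pwDl.
exists (2 `^ q * V K0); first exact: mulr_gt0.
move=> K KK.
have FK : 0 < F K%:R by rewrite Fpos// ltr0n.
rewrite -ler_pdivrMr//; apply: (@le_trans _ _ (V K)); first by rewrite lerDl mulr_ge0.
have /andP[tl tu] := @trunc_log_bounds 2 K isT KK.
apply: (le_trans (Vmono _ _ KK (_ : _ <= 2 ^ (trunc_log 2 K).+1 * K0)%N)).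
  by apply: (leq_trans (ltnW tu)); rewrite leq_pmulr.
apply: (le_trans (Viter _)); rewrite exprS mulrAC; apply: ler_wpM2l.
  by rewrite mulr_ge0 ?(ltW V0) ?(ltW p0).
rewrite -powR_mulrn ?(ltW p0)// -powRrM mulrC powRrM powR_mulrn//.
by apply: ge0_ler_powR; rewrite ?nnegrE ?exprn_ge0// -?natrX ?ler_nat//; lra.
Qed.

End regular_variation.

(** Comparing H x with F (c * x) for c close to 1 / m pins down the limit of the
    ratio, because F (c * x) / F x tends to c `^ (- beta), which is continuous in c
    and equals m `^ beta at c = 1 / m. *)
Lemma regular_variation_ratio_cvg {R : realType} (F H : R -> R) (beta m : R) :
  0 < m -> (forall x, 0 < x -> 0 < F x) ->
  (forall q, 0 < q -> F (q * x) / F x @[x --> +oo] --> q `^ (- beta)) ->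
  (forall c, 0 < c -> c * m < 1 -> exists2 e : R -> R,
    e x @[x --> +oo] --> (0 : R) &
    \forall x \near +oo, H x <= F (c * x) * (1 + e x)) ->
  (forall c, 0 < c -> 1 < c * m -> exists2 e : R -> R,
    e x @[x --> +oo] --> (0 : R) &
    \forall x \near +oo, F (c * x) * (1 - e x) <= H x) ->
  H x / F x @[x --> +oo] --> m `^ beta.
Proof.
move=> m0 Fpos Frv hup hlo.
have powc t : 0 < t -> (t / m) `^ (- beta) = t `^ (- beta) * m `^ beta.
  move=> t0; rewrite powRM ?invr_ge0 ?(ltW t0) ?(ltW m0)//; congr (_ * _).
  by rewrite -powR_inv1 ?(ltW m0)// -powRrM mulN1r opprK.
have cvgt : t `^ (- beta) * m `^ beta @[t --> (1 : R)] --> m `^ beta.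
  by rewrite -[X in _ --> X]mul1r; apply: cvgMl; exact: cvg_powR1.
have up l : m `^ beta < l -> \forall x \near +oo, H x / F x < l.
  move=> ml.
  have [t [t0 t1 tl]] : exists t, [/\ 0 < t, t < 1 & t `^ (- beta) * m `^ beta < l].
    have h := cvgr_lt _ (cvg_at_left_filter cvgt) _ ml.
    near (1 : R)^'- => t; exists t; split.
    - by near: t; apply: nbhs_left_gt.
    - by near: t; exact: nbhs_left_lt.
    - by near: t; exact: h.
  have c0 : 0 < t / m by exact: divr_gt0.
  have [//||e e0 he] := hup (t / m); first by rewrite divfK// lt0r_neq0.
  have cu : F (t / m * x) / F x * (1 + e x) @[x --> +oo] --> (t / m) `^ (- beta).
    rewrite -[X in _ --> X]mulr1; apply: cvgM; first exact: Frv.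
    by rewrite -[X in _ --> X]addr0; apply: cvgD => //; exact: cvg_cst.
  rewrite -powc// in tl; have h := cvgr_lt _ cu _ tl.
  near=> x; apply: (@le_lt_trans _ _ (F (t / m * x) / F x * (1 + e x))).
    rewrite mulrAC ler_pM2r ?invr_gt0 ?Fpos//; by near: x.
  by near: x; exact: h.
have lo l : l < m `^ beta -> \forall x \near +oo, l < H x / F x.
  move=> ml.
  have [t [t1 tl]] : exists t, 1 < t /\ l < t `^ (- beta) * m `^ beta.
    have h := cvgr_gt _ (cvg_at_right_filter cvgt) _ ml.
    near (1 : R)^'+ => t; exists t; split; last by near: t; exact: h.
    by near: t; exact: nbhs_right_gt.
  have t0 : 0 < t by exact: lt_trans t1.
  have c0 : 0 < t / m by exact: divr_gt0.
  have [//||e e0 he] := hlo (t / m); first by rewrite divfK// lt0r_neq0.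
  have cu : F (t / m * x) / F x * (1 - e x) @[x --> +oo] --> (t / m) `^ (- beta).
    rewrite -[X in _ --> X]mulr1; apply: cvgM; first exact: Frv.
    by rewrite -[X in _ --> X]subr0; apply: cvgB => //; exact: cvg_cst.
  rewrite -powc// in tl; have h := cvgr_gt _ cu _ tl.
  near=> x; apply: (@lt_le_trans _ _ (F (t / m * x) / F x * (1 - e x))).
    by near: x; exact: h.
  rewrite mulrAC ler_pM2r ?invr_gt0 ?Fpos//; by near: x.
apply/cvgrPdist_lt => eta eta0.
have h1 := up (m `^ beta + eta); have h2 := lo (m `^ beta - eta).
near=> x; rewrite ltr_distlC; apply/andP; split; near: x.
- by apply: h2; rewrite ltrBlDr ltrDl.
- by apply: h1; rewrite ltrDl.
Unshelve. all: by end_near. Qed.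

(** * Events independent of a family of variables *)

Section independent_events.
Context {d : measure_display} {T : measurableType d} {R : realType}
  {P : probability T R} {I : choiceType} (Y : I -> {RV P >-> nat}).

Definition cylinder (J : {fset I}) (A : I -> set nat) : set T :=
  \bigcap_(j in [set` J]) Y j @^-1` A j.

(** Independence of B from the sigma-algebra generated by the [Y i], i in D,
    tested on the pi-system of finite cylinders. *)
Definition indep_event (D : set I) (B : set T) : Prop :=
  measurable B /\
  forall (J : {fset I}) (A : I -> set nat), [set` J] `<=` D ->
    P (B `&` cylinder J A) = (P B * \prod_(j <- J) P (Y j @^-1` A j))%E.

Lemma measurable_natrv (Z : {RV P >-> nat}) (A : set nat) :
  measurable (Z @^-1` A).
Proof. by rewrite -[X in measurable X]setTI; exact: measurable_funP. Qed.

Lemma measurable_cylinder J A : measurable (cylinder J A).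
Proof.
apply: fin_bigcap_measurable => // j _; exact: measurable_natrv.
Qed.

Lemma indep_event_sub D D' B : D' `<=` D -> indep_event D B -> indep_event D' B.
Proof. by move=> DD [mB iB]; split=> // J A /subset_trans/(_ DD)/iB. Qed.

Lemma indep_eventT D : mutually_independent Y -> indep_event D setT.
Proof.
move=> iY; split=> // J A _; rewrite setTI probability_setT mul1e.
exact: (iY J A).
Qed.

(** Conditioning on [Y k] uses up the index k: what remains is independent of the
    other variables. *)
Lemma indep_eventI D B k A0 : D k -> indep_event D B ->
  P (B `&` Y k @^-1` A0) = (P B * P (Y k @^-1` A0))%E /\
  indep_event (D `\ k) (B `&` Y k @^-1` A0).
Proof.
move=> Dk [mB iB].
have e1 : P (B `&` Y k @^-1` A0) = (P B * P (Y k @^-1` A0))%E.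
  have := iB [fset k]%fset (fun=> A0); rewrite big_seq_fset1 => <-.
    congr (P (_ `&` _)); apply/seteqP; split=> w /=.
      by move=> h j /=; rewrite inE => /eqP->.
    by move=> /(_ k); apply; rewrite /= inE.
  by move=> j /=; rewrite inE => /eqP->.
split=> //; split; first by apply: measurableI => //; exact: measurable_natrv.
move=> J A JD.
have kJ : k \notin J by apply/negP => /JD [_]; apply.
pose A' j := if j == k then A0 else A j.
have A'J j : j \in J -> A' j = A j.
  by rewrite /A'; case: eqP => // ->; rewrite (negbTE kJ).
have EA : (\prod_(j <- J) P (Y j @^-1` A' j) = \prod_(j <- J) P (Y j @^-1` A j))%E.
  by apply: eq_big_seq => j /A'J ->.
have := iB (fsetU [fset k]%fset J) A'.
rewrite big_fsetU1//= {2}/A' eqxx EA muleA -e1 => <-; last first.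
  by move=> j /=; rewrite !inE => /orP[/eqP->//|/JD[]].
rewrite -setIA; congr (P (_ `&` _)); apply/seteqP; split=> w /=.
  move=> [wk wJ] j /=; rewrite !inE => /orP[/eqP->|jJ]; first by rewrite /A' eqxx.
  by rewrite A'J//; exact: wJ.
move=> h; split.
  by have := h k; rewrite /A' /= eqxx; apply; rewrite !inE eqxx.
move=> j jJ; rewrite -A'J//; apply: h; rewrite /= !inE.
by apply/orP; right.
Qed.

Lemma indep_event_bigcup D (B : nat -> set T) : trivIset setT B ->
  (forall n, indep_event D (B n)) -> indep_event D (\bigcup_n B n).
Proof.
move=> tB iB; have mB n : measurable (B n) by case: (iB n).
split; first exact: bigcupT_measurable.
move=> J A JD; rewrite setI_bigcupl !measure_bigcup//.
- have -> : (\prod_(j <- J) P (Y j @^-1` A j))%E =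
    (fine (\prod_(j <- J) P (Y j @^-1` A j))%E)%:E.
    rewrite fineK// prode_fin_num// => j _; rewrite fin_num_measure//.
    exact: measurable_natrv.
  rewrite muleC -nneseriesZl//; apply: eq_eseriesr => n _.
  rewrite /= (iB n).2// muleC fineK// prode_fin_num// => j _.
  by rewrite fin_num_measure//; exact: measurable_natrv.
- by move=> n _; apply: measurableI => //; exact: measurable_cylinder.
- exact: trivIset_setIr.
Qed.

Lemma indep_event0 D : indep_event D set0.
Proof. by split=> // J A _; rewrite set0I measure0 mul0e. Qed.

(** This is how a property known for the values of one variable is passed to a
    function of several: it suffices to prove independence once the values of
    the variables involved are fixed. *)
Lemma indep_event_partition (f : T -> nat) D B :
  (forall n, indep_event D (B `&` f @^-1` [set n])) -> indep_event D B.
Proof.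
move=> iB; suff -> : B = \bigcup_n (B `&` f @^-1` [set n]).
  apply: indep_event_bigcup => //; apply/trivIsetP => i j _ _ ij.
  apply/seteqP; split=> // w [[_ /= fi] [_ /= fj]].
  by move: ij; rewrite -fi -fj eqxx.
apply/seteqP; split=> [w Bw|w [n _ []]//].
by exists (f w).
Qed.

Lemma indep_event_preimage (Z : T -> nat) D A :
  (forall n, indep_event D (Z @^-1` [set n])) -> indep_event D (Z @^-1` A).
Proof.
move=> iZ; apply: (@indep_event_partition Z) => n.
have [An|An] := pselect (A n).
  rewrite (_ : _ `&` _ = Z @^-1` [set n])//.
  by apply/seteqP; split=> [w []//|w /= ->].
rewrite (_ : _ `&` _ = set0); first exact: indep_event0.
by apply/seteqP; split=> // w /= [+ wn]; rewrite wn.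
Qed.

Lemma indep_event_sum (k : nat -> I) n D D' B s : injective k ->
  D' `<=` D -> (forall i, (i < n)%N -> D (k i) /\ ~ D' (k i)) ->
  indep_event D B ->
  indep_event D' (B `&` [set w | \sum_(i < n) Y (k i) w = s]%N).
Proof.
move=> injk; elim: n D' s => [|n IHn] D' s DD hk iB.
  have [->|s0] := eqVneq s 0%N.
    rewrite (_ : _ `&` _ = B); first exact: indep_event_sub iB.
    by apply/seteqP; split=> [w []//|w Bw]; split=> //=; rewrite big_ord0.
  rewrite (_ : _ `&` _ = set0); first exact: indep_event0.
  by apply/seteqP; split=> // w [_ /=]; rewrite big_ord0 => /esym/eqP; rewrite (negbTE s0).
have [Dkn D'kn] := hk n (ltnSn n).
apply: (@indep_event_partition (Y (k n))) => v.
have [vs|vs] := leqP v s; last first.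
  rewrite (_ : _ `&` _ = set0); first exact: indep_event0.
  by apply/seteqP; split=> // w /= [[_]]; rewrite big_ord_recr/= => h1 h2; lia.
rewrite (_ : _ `&` _ = (B `&` [set w | \sum_(i < n) Y (k i) w = s - v]%N) `&`
  Y (k n) @^-1` [set v]); last first.
  apply/seteqP; split=> w /= [[Bw]]; rewrite ?big_ord_recr/= => h1 h2.
    by split=> //; split=> //; lia.
  by split=> //; split=> //; lia.
have := IHn (k n |` D') (s - v)%N.
move=> /(_ _ _ iB) H.
apply: (indep_event_sub _ (indep_eventI [set v] _ (H _ _)).2).
- by move=> j D'j; split; [right|move=> /= jk; rewrite jk in D'j].
- by left.
- by move=> j [->|/DD].
- move=> i iltn; have [] := hk i (leqW iltn); split=> //.
  by move=> [/injk ?|//]; lia.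
Qed.

End independent_events.

Section compound_independence.
Context {d : measure_display} {T : measurableType d} {R : realType}
  {P : probability T R} {I : choiceType} (Y : I -> {RV P >-> nat}).

(** Once the values of X and of [Y e] are fixed, the event S = n concerns a sum
    with a deterministic number of terms. *)
Lemma indep_event_compound (D D' : set I) (k : nat -> I) (e : I)
    (X S : T -> nat) :
  injective k -> D' `<=` D -> (forall i, [/\ D (k i), ~ D' (k i) & k i <> e]) ->
  D e -> ~ D' e ->
  (forall n, indep_event Y D (X @^-1` [set n])) ->
  (forall w, S w = (\sum_(i < X w) Y (k i) w + Y e w)%N) ->
  forall n, indep_event Y D' (S @^-1` [set n]).
Proof.
move=> injk DD hk De D'e iX SE n.
apply: (@indep_event_partition _ _ _ _ _ _ X) => a.
apply: (@indep_event_partition _ _ _ _ _ _ (Y e)) => v.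
have [vn|vn] := leqP v n; last first.
  rewrite (_ : _ `&` _ = set0); first exact: indep_event0.
  by apply/seteqP; split=> // w /= [[]]; rewrite SE => + _ ev; lia.
rewrite (_ : _ `&` _ = (X @^-1` [set a] `&`
    [set w | \sum_(i < a) Y (k i) w = n - v]%N) `&` Y e @^-1` [set v]); last first.
  apply/seteqP; split=> w /= [[]]; rewrite SE.
    by move=> h Xa ev; split=> //; split=> //=; rewrite -h -ev Xa addnK.
  by move=> Xa h ev; rewrite Xa h ev subnK.
have H : indep_event Y (e |` D') (X @^-1` [set a] `&`
    [set w | \sum_(i < a) Y (k i) w = n - v]%N).
  apply: (@indep_event_sum _ _ _ _ _ _ _ _ D) => //.
  - by move=> i [->|/DD].
  - by move=> i _; have [? ? ?] := hk i; split=> // -[].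
apply: (indep_event_sub _ (indep_eventI [set v] _ H).2); last by left.
by move=> i D'i; split; [right|move=> /= ie; rewrite ie in D'i].
Qed.

End compound_independence.

(** * A Chernoff bound under conditioning *)

Section pr.
Context {d : measure_display} {T : measurableType d} {R : realType}
  (P : probability T R).

Definition pr (A : set T) : R := fine (P A).

Lemma pr_ge0 A : 0 <= pr A.
Proof. exact: fine_ge0. Qed.

Lemma prE A : measurable A -> P A = (pr A)%:E.
Proof. by move=> mA; rewrite fineK// fin_num_measure. Qed.

Lemma pr_setT : pr setT = 1.
Proof. by rewrite /pr probability_setT. Qed.

Lemma pr_mono A B : measurable A -> measurable B -> A `<=` B -> pr A <= pr B.
Proof.
by move=> mA mB AB; rewrite -lee_fin -!prE//; apply: le_measure; rewrite ?inE.
Qed.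

Lemma pr_subadditive n (A : set T) (F : nat -> set T) : measurable A ->
  (forall i, (i < n)%N -> measurable (F i)) ->
  (forall w, A w -> exists2 i, (i < n)%N & F i w) ->
  pr A <= \sum_(i < n) pr (F i).
Proof.
move=> mA mF AF; rewrite -lee_fin -prE// -sumEFin.
rewrite (eq_bigr (fun i : 'I_n => P (F i))); last by move=> i _; rewrite -prE//; exact: mF.
apply: content_subadditive => // w /AF[i ilt Fiw].
by rewrite -bigcup_mkord; exists i.
Qed.

Lemma pr_setU2 A B : measurable A -> measurable B ->
  pr (A `|` B) <= pr A + pr B.
Proof.
move=> mA mB; rewrite -lee_fin EFinD -!prE//; last exact: measurableU.
exact: measureU2.
Qed.

Lemma pr_setC A : measurable A -> pr (~` A) = 1 - pr A.
Proof.
move=> mA; apply/EFin_inj; rewrite EFinB -!prE//; last exact: measurableC.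
exact: probability_setC.
Qed.

Context {I : choiceType} (Y : I -> {RV P >-> nat}).

Lemma pr_indepI D B k A : D k -> indep_event Y D B ->
  pr (B `&` Y k @^-1` A) = pr B * pr (Y k @^-1` A).
Proof.
move=> Dk iB; have mB := iB.1.
rewrite /pr (indep_eventI A Dk iB).1 fineM// fin_num_measure//.
exact: measurable_natrv.
Qed.

Lemma measurable_sum_ge n (f : nat -> nat -> R) (Z : nat -> {RV P >-> nat}) t :
  measurable [set w | t <= \sum_(i < n) f i (Z i w)].
Proof.
rewrite (_ : [set w | _] = (fun w => \sum_(i < n) f i (Z i w)) @^-1` `[t, +oo[).
  rewrite -[X in measurable X]setTI.
  have : measurable_fun setT (fun w => \sum_(i < n) f i (Z i w)).
    apply: measurable_sum => i.
    by apply: (@measurableT_comp _ _ _ _ _ _ (f i) _ (Z i)).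
  by apply.
by apply/seteqP; split=> w /=; rewrite in_itv/= andbT.
Qed.

(** Instead of factoring the expectation of a product of exponentials, the last
    variable is conditioned upon: its truncation takes the finitely many values
    v <= N, on each of which the remaining sum has to exceed t - phi v, and the
    induction hypothesis applies to the smaller event. *)
Lemma indep_sum_chernoff (phi : nat -> R) N c (k : nat -> I) n D B t :
  injective k -> (forall i, (i < n)%N -> D (k i)) -> 0 <= c ->
  (forall v, phi v = phi (minn v N)) ->
  (forall i, (i < n)%N ->
    \sum_(v < N.+1) pr (Y (k i) @^-1` [set u | minn u N = v]) * expR (phi v) <= c) ->
  indep_event Y D B ->
  pr (B `&` [set w | t <= \sum_(i < n) phi (Y (k i) w)]) <=
    pr B * expR (- t) * c ^+ n.
Proof.
move=> injk + c0 phiN; elim: n D B t => [|n IHn] D B t Dk hc iB.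
  have mB := iB.1; rewrite expr0 mulr1; have [t0|t0] := leP t 0.
    rewrite (_ : _ `&` _ = B).
      rewrite ler_peMr// ?pr_ge0//.
      by apply: le_trans (expR_ge1Dx _); rewrite lerDl oppr_ge0.
    by apply/seteqP; split=> [w []//|w Bw]; split=> //=; rewrite big_ord0.
  rewrite (_ : _ `&` _ = set0).
    by rewrite /pr measure0 /=; apply: mulr_ge0; rewrite ?expR_ge0 ?pr_ge0.
  by apply/seteqP; split=> // w [_ /=]; rewrite big_ord0 leNgt t0.
have mB := iB.1.
pose A v := Y (k n) @^-1` [set u | minn u N = v].
pose F v := (B `&` A v) `&`
  [set w | t - phi v <= \sum_(i < n) phi (Y (k i) w)].
have mF v : measurable (F v).
  apply: measurableI; first by apply: measurableI => //; exact: measurable_natrv.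
  exact: (measurable_sum_ge _ (fun=> phi) (fun i => Y (k i))).
have : pr (B `&` [set w | t <= \sum_(i < n.+1) phi (Y (k i) w)]) <=
    \sum_(v < N.+1) pr (F v).
  apply: pr_subadditive.
  - apply: measurableI => //.
    exact: (measurable_sum_ge _ (fun=> phi) (fun i => Y (k i))).
  - by [].
  - move=> w [Bw /=]; rewrite big_ord_recr/= => tw.
    exists (minn (Y (k n) w) N); first by rewrite ltnS geq_minr.
    by split=> //=; rewrite -phiN lerBlDr.
move=> /le_trans; apply.
have Dkn : D (k n) by exact: Dk.
apply: (@le_trans _ _ (pr B * expR (- t) * c ^+ n *
    \sum_(v < N.+1) pr (A v) * expR (phi v))).
  rewrite mulr_sumr; apply: ler_sum => v _.
  have [_ iBA] := indep_eventI [set u | minn u N = v] Dkn iB.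
  have := IHn _ _ (t - phi v) _ _ iBA.
  move=> /(_ _ _)/le_trans; apply.
  - move=> i iltn; split; first by apply: Dk; lia.
    by move=> /= /injk; lia.
  - by move=> i iltn; apply: hc; lia.
  - rewrite (pr_indepI _ Dkn iB) -/(A v) opprB expRD.
    rewrite le_eqVlt; apply/orP; left; apply/eqP; rewrite -/(A v); ring.
rewrite exprSr mulrA; apply: ler_wpM2l; last exact: hc.
by rewrite !mulr_ge0 ?pr_ge0 ?expR_ge0 ?exprn_ge0.
Qed.

End pr.

(** * Moments of integer-valued variables and of their truncations *)

Section moments.
Context {d : measure_display} {T : measurableType d} {R : realType}
  {P : probability T R} (Z : {RV P >-> nat}).

Let meas (g : nat -> R) (D : set T) : measurable_fun D (EFin \o (fun w => g (Z w))).
Proof.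
apply: measurable_funTS; apply/measurable_EFinP.
by apply: (@measurableT_comp _ _ _ _ _ _ g _ Z).
Qed.

Lemma expect_nat_le (g h : nat -> R) : (forall v, 0 <= g v <= h v) ->
  (\int[P]_w (g (Z w))%:E <= \int[P]_w (h (Z w))%:E)%E.
Proof.
move=> gh; apply: ge0_le_integral => //.
- by move=> w _; rewrite lee_fin; case/andP: (gh (Z w)).
- exact: meas.
- exact: meas.
- by move=> w _; rewrite lee_fin; case/andP: (gh (Z w)).
Qed.

Definition trunc_pmf N (v : nat) : R :=
  pr P (Z @^-1` [set u | minn u N = v]).

Lemma expect_trunc (g : nat -> R) N : (forall v, 0 <= g v) ->
  (\int[P]_w (g (minn (Z w) N))%:E)%E =
  (\sum_(v < N.+1) trunc_pmf N v * g v)%:E.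
Proof.
move=> g0.
rewrite (eq_integral (fun w => \sum_(v < N.+1)
    ((g v)%:E * (\1_(Z @^-1` [set u | minn u N = v]) w)%:E))%E); last first.
  move=> w _; have ltN : (minn (Z w) N < N.+1)%N by rewrite ltnS geq_minr.
  rewrite (bigD1 (Ordinal ltN))//= big1 ?adde0.
    by rewrite indicE mem_set// mule1.
  move=> i ij; rewrite indicE memNset ?mule0//= => e.
  by move: ij; rewrite -val_eqE /= e eqxx.
rewrite ge0_integral_sum//; last 2 first.
- move=> v; apply/measurable_EFinP; apply: measurable_funM => //.
  by apply: measurable_indic; exact: measurable_natrv.
- by move=> v w _; rewrite mule_ge0 ?lee_fin.
rewrite -sumEFin; apply: eq_bigr => v _.
rewrite ge0_integralZl_EFin//; last first.
  by apply/measurable_EFinP; apply: measurable_indic; exact: measurable_natrv.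
rewrite integral_indic ?setIT//; last exact: measurable_natrv.
by rewrite muleC EFinM /trunc_pmf -prE//; exact: measurable_natrv.
Qed.

Context (r : R).
Hypothesis r1 : 1 < r.
Let r0 : 0 <= r. Proof. exact: ltW (lt_trans ltr01 r1). Qed.
Let rm1 : 0 <= r - 1. Proof. by rewrite subr_ge0 ltW. Qed.
Hypothesis Zr : ('E_P[(fun w => natr_rv Z w `^ r)%R] < +oo)%E.

Let M := fine 'E_P[(fun w => natr_rv Z w `^ r)%R].
Let m := fine 'E_P[natr_rv Z].

Let EME : (\int[P]_w ((Z w)%:R `^ r)%:E)%E = M%:E.
Proof.
rewrite /M fineK; first by rewrite unlock.
rewrite ge0_fin_numE// expectation_ge0// => x; exact: powR_ge0.
Qed.

Lemma moment_ge0 : 0 <= M.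
Proof. by rewrite fine_ge0// expectation_ge0// => x; exact: powR_ge0. Qed.

Lemma powR_nat_ge (v : nat) : v%:R <= v%:R `^ r :> R.
Proof.
case: v => [|v]; first exact: powR_ge0.
by apply: le1r_powR; rewrite ?ler1n// ltW.
Qed.

Let EmE : (\int[P]_w ((Z w)%:R)%:E)%E = m%:E.
Proof.
rewrite /m fineK; first by rewrite unlock.
rewrite ge0_fin_numE ?expectation_ge0//.
rewrite unlock; apply: (@le_lt_trans _ _ M%:E); last exact: ltry.
rewrite -EME; apply: (expect_nat_le (g := fun v => v%:R) (h := fun v => v%:R `^ r)) => v.
by rewrite ler0n powR_nat_ge.
Qed.

Lemma trunc_pmf_ge0 N v : 0 <= trunc_pmf N v.
Proof. exact: pr_ge0. Qed.

Lemma trunc_pmf_sum1 N : \sum_(v < N.+1) trunc_pmf N v = 1.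
Proof.
have := @expect_trunc (fun=> 1) N (fun=> ler01).
rewrite integral_cst//= probability_setT mule1 => h; apply/EFin_inj.
rewrite -[RHS]/(1%E) h; congr EFin; by apply: eq_bigr => v _; rewrite mulr1.
Qed.

Lemma trunc_mean_le N : \sum_(v < N.+1) trunc_pmf N v * v%:R <= m.
Proof.
rewrite -lee_fin -EmE -(@expect_trunc (fun v => v%:R) N)//.
apply: (@expect_nat_le (fun v => (minn v N)%:R) (fun v => v%:R)) => v.
by rewrite ler0n ler_nat geq_minl.
Qed.

Lemma trunc_moment_le N : \sum_(v < N.+1) trunc_pmf N v * v%:R `^ r <= M.
Proof.
rewrite -lee_fin -EME -(@expect_trunc (fun v => v%:R `^ r) N); last by move=> v; exact: powR_ge0.
apply: (@expect_nat_le (fun v => (minn v N)%:R `^ r) (fun v => v%:R `^ r)) => v.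
by rewrite powR_ge0/= ge0_ler_powR ?nnegrE ?ler0n// ler_nat geq_minl.
Qed.

(** The mean lost by truncating: when v > N, v <= N `^ (1 - r) * v `^ r. *)
Lemma le_trunc_mean N : (0 < N)%N ->
  m <= \sum_(v < N.+1) trunc_pmf N v * v%:R + M * N%:R `^ (1 - r).
Proof.
move=> N0; have NR0 : 0 < N%:R :> R by rewrite ltr0n.
rewrite -lee_fin -EmE EFinD -(@expect_trunc (fun v => v%:R) N)// mulrC EFinM -EME.
rewrite -ge0_integralZl_EFin ?powR_ge0//; last exact: (meas (fun v => v%:R `^ r)).
rewrite -ge0_integralD//; last 2 first.
- exact: (meas (fun v => (minn v N)%:R)).
- exact: (meas (fun v => N%:R `^ (1 - r) * (v%:R `^ r))).
apply: (@expect_nat_le (fun v => v%:R)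
  (fun v => (minn v N)%:R + N%:R `^ (1 - r) * (v%:R `^ r))) => v.
rewrite ler0n/=; have [vN|Nv] := leqP v N.
  by rewrite lerDl mulr_ge0 ?powR_ge0.
have v0 : 0 < v%:R :> R by rewrite ltr0n (leq_trans _ Nv).
apply: (@le_trans _ _ (N%:R `^ (1 - r) * v%:R `^ r)); last by rewrite lerDr.
rewrite -(@mulr_powRB1 _ v%:R r) ?(ltW v0)//; last exact: lt_trans ltr01 r1.
rewrite mulrCA ler_peMr ?(ltW v0)// -opprB powRN mulrC ler_pdivlMr ?powR_gt0// mul1r.
by rewrite ge0_ler_powR ?nnegrE ?ler0n ?ler_nat ?(ltnW Nv)//.
Qed.

Lemma moment_tail y : 0 < y -> pr P [set w | y <= (Z w)%:R] <= M * y `^ (- r).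
Proof.
move=> y0; rewrite powRN ler_pdivlMr ?powR_gt0//.
rewrite -lee_fin -EME mulrC EFinM -prE; last exact: (measurable_natrv Z [set v | y <= v%:R]).
set A := [set w | _].
have mA : measurable A by exact: (measurable_natrv Z [set v | y <= v%:R]).
rewrite -[X in P X]setIT -integral_indic//.
rewrite -ge0_integralZl_EFin ?powR_ge0//; last exact/measurable_EFinP/measurable_indic.
rewrite (eq_integral (fun w => (y `^ r * (y <= (Z w)%:R)%R%:R)%:E)).
  apply: (@expect_nat_le (fun v => y `^ r * (y <= v%:R)%R%:R) (fun v => v%:R `^ r)) => v.
  rewrite mulr_ge0 ?powR_ge0//=; case: (boolP (y <= _)) => yv; last by rewrite mulr0 powR_ge0.
  by rewrite mulr1 ge0_ler_powR ?nnegrE ?ler0n ?(ltW y0)//.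
move=> w _; rewrite -EFinM indicE /A; congr (_ * (nat_of_bool _)%:R)%:E.
by apply/idP/idP; rewrite inE.
Qed.

Lemma mean_gt0 : (P (Z @^-1` [set 0%N]) < 1)%E -> 0 < m.
Proof.
move=> Z0; have mZ0 : measurable (Z @^-1` [set 0%N]) by exact: measurable_natrv.
have : pr P (~` (Z @^-1` [set 0%N])) <= m.
  rewrite -lee_fin -EmE -prE; last exact: measurableC.
  rewrite -[X in P X]setIT -integral_indic//; last exact: measurableC.
  rewrite (eq_integral (fun w => ((Z w != 0%N)%:R)%:E)).
    apply: (@expect_nat_le (fun v => (v != 0%N)%:R) (fun v => v%:R)) => v.
    by rewrite ler0n ler_nat; case: v.
  move=> w _; rewrite indicE; congr ((nat_of_bool _)%:R)%:E; apply/idP/idP.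
    by rewrite inE => /eqP.
  by move=> /eqP h; rewrite inE.
apply: lt_le_trans; rewrite pr_setC// subr_gt0.
by rewrite -lte_fin -prE.
Qed.

End moments.

Lemma identically_distributed_moment {d : measure_display}
    {T : measurableType d} {R : realType} {P : probability T R} (r : R)
    (Z Z' : {RV P >-> nat}) :
  identically_distributed Z Z' ->
  ('E_P[(fun w => natr_rv Z w `^ r)%R] = 'E_P[(fun w => natr_rv Z' w `^ r)%R])%E.
Proof.
move=> ZZ'; rewrite unlock.
have E (W : {RV P >-> nat}) :
    (\int[P]_w (natr_rv W w `^ r)%:E = \int[distribution P W]_v (v%:R `^ r)%:E)%E.
  rewrite ge0_integral_distribution// => v; rewrite lee_fin; exact: powR_ge0.
by rewrite !E; apply: eq_measure_integral => A mA _; exact: ZZ'.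
Qed.

(** As expR (- u) >= 1 - u, one has expR u <= 1 / (1 - u). *)
Lemma expR_le_quadratic {R : realType} (u : R) : u <= 2^-1 ->
  expR u <= 1 + u + 2 * u ^+ 2.
Proof.
move=> u2; have u1 : 0 < 1 - u by lra.
rewrite -[expR u]invrK -expRN.
apply: (@le_trans _ _ (1 - u)^-1).
  by rewrite lef_pV2 ?posrE ?expR_gt0//; have := expR_ge1Dx (- u).
rewrite -div1r ler_pdivrMr//.
have : 0 <= u ^+ 2 * (1 - 2 * u) by rewrite mulr_ge0 ?sqr_ge0//; lra.
by nra.
Qed.

Section mgf.
Context {d : measure_display} {T : measurableType d} {R : realType}
  {P : probability T R} (Z : {RV P >-> nat}).

(** Exponential moments of the truncation of Z at N, at the scale
    1 / (2 N) where the exponent is at most 1 / 2. The second-order term is at most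
    (v / N) ^ 2 / 2, hence at most v `^ r * N `^ (- s) / 2 with s = min(r, 2); in the
    case sigma = -1, the mean lost by the truncation contributes the same
    amount. As s > 1, the error is negligible with respect to 1 / N. *)
Lemma trunc_mgf_le (r sigma : R) N : 1 < r ->
  ('E_P[(fun w => natr_rv Z w `^ r)%R] < +oo)%E ->
  (0 < N)%N -> `|sigma| = 1 ->
  \sum_(v < N.+1) trunc_pmf Z N v * expR (sigma * v%:R / (2 * N%:R)) <=
  expR (sigma * fine 'E_P[natr_rv Z] / (2 * N%:R) +
    fine 'E_P[(fun w => natr_rv Z w `^ r)%R] * N%:R `^ (- Num.min r 2)).
Proof.
move=> r1 Zr N0 sigma1.
set m := fine 'E_P[natr_rv Z]; set M := fine _.
set s := Num.min r 2.
have M0 : 0 <= M by exact: moment_ge0.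
have s1 : 1 < s by rewrite lt_min r1/=; lra.
have [sr s2] : s <= r /\ s <= 2 by split; rewrite ge_min lexx ?orbT.
have NR1 : 1 <= N%:R :> R by rewrite ler1n.
have NR0 : 0 < N%:R :> R by rewrite ltr0n.
have sg : sigma ^+ 2 = 1.
  by rewrite -real_normK ?num_real// sigma1 expr1n.
have bound (v : 'I_N.+1) : expR (sigma * v%:R / (2 * N%:R)) <=
    1 + sigma / (2 * N%:R) * v%:R + N%:R `^ (- s) / 2 * v%:R `^ r.
  have vN : v%:R <= N%:R :> R by rewrite ler_nat -ltnS.
  have sle : sigma <= 1 by rewrite -sigma1 ler_norm.
  apply: le_trans (expR_le_quadratic _) _.
    rewrite ler_pdivrMr ?mulr_gt0// mulrA mulVf// mul1r.
    by apply: le_trans vN; exact: ler_piMl.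
  rewrite -addrA -addrA lerD2l; apply: lerD; first by rewrite mulrAC.
  rewrite !exprMn exprVn exprMn sg mul1r.
  rewrite [leLHS](_ : _ = (v%:R / N%:R) ^+ 2 / 2); last first.
    by field; apply: lt0r_neq0.
  rewrite [leRHS]mulrAC; apply: ler_wpM2r => //.
  have [->|v0] := eqVneq (nat_of_ord v) 0%N.
    by rewrite mul0r expr0n/= mulr_ge0 ?powR_ge0.
  have vR1 : 1 <= v%:R :> R by rewrite ler1n lt0n.
  have vR0 : 0 < v%:R :> R by lra.
  rewrite -powR_mulrn ?divr_ge0// ?(ltW vR0)//.
  apply: (@le_trans _ _ ((v%:R / N%:R) `^ s)).
    apply: ger_powR => //; apply/andP; split; first exact: divr_gt0.
    by rewrite ler_pdivrMr// mul1r.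
  rewrite powRM ?invr_ge0 ?(ltW NR0)// ?(ltW vR0)//.
  rewrite -powR_inv1 ?(ltW NR0)// -powRrM mulN1r mulrC.
  by apply: ler_wpM2l; [exact: powR_ge0|exact: ler_powR].
apply: (@le_trans _ _ (\sum_(v < N.+1) trunc_pmf Z N v *
  (1 + sigma / (2 * N%:R) * v%:R + N%:R `^ (- s) / 2 * v%:R `^ r))).
  by apply: ler_sum => v _; apply: ler_wpM2l; [exact: trunc_pmf_ge0|exact: bound].
under eq_bigr do rewrite mulrDr mulrDr mulr1 mulrCA (mulrCA _ (_ / 2)).
rewrite !big_split/= -!mulr_sumr trunc_pmf_sum1//.
have h1 := trunc_mean_le r1 Zr N.
have h2 := le_trunc_mean r1 Zr N0.
have h3 := trunc_moment_le r1 Zr N.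
rewrite -/m -/M in h1 h2 h3.
move: h1 h2 h3; set mN := \sum_(_ < _) _; set MN := \sum_(_ < _) _ => h1 h2 h3.
apply: le_trans (expR_ge1Dx _); rewrite -addrA lerD2l.
have NE : N%:R `^ (1 - r) <= N%:R * N%:R `^ (- s).
  rewrite -[X in X * _]powRr1 ?(ltW NR0)// -powRD ?(lt0r_neq0 NR0) ?implybT//.
  by apply: ler_powR => //; lra.
have sm : sigma * mN <= sigma * m + M * (N%:R * N%:R `^ (- s)).
  have := ler_wpM2l M0 NE.
  have : 0 <= M * N%:R `^ (1 - r) by rewrite mulr_ge0// powR_ge0.
  have [->|->] : sigma = 1 \/ sigma = -1.
    have /eqP := sg; rewrite sqrf_eq1 => /orP[/eqP->|/eqP->]; [by left|by right].
  - by lra.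
  - by lra.
have q0 : 0 <= N%:R `^ (- s) := powR_ge0 _ _.
set q := N%:R `^ (- s) in sm q0 *.
have e1 : sigma / (2 * N%:R) * mN <= sigma * m / (2 * N%:R) + M * q / 2.
  rewrite mulrAC (_ : _ + _ = (sigma * m + M * (N%:R * q)) / (2 * N%:R)); last first.
    by field; apply: lt0r_neq0.
  by apply: ler_wpM2r sm; rewrite invr_ge0 mulr_ge0.
have e2 : q / 2 * MN <= M * q / 2.
  rewrite mulrAC -[X in _ <= X](_ : q * M / 2 = _); last by rewrite (mulrC M).
  by apply: ler_wpM2r => //; exact: ler_wpM2l.
by lra.
Qed.

End mgf.

(** * Tails of random sums *)

Section compound.
Context {d : measure_display} {T : measurableType d} {R : realType}
  {P : probability T R}.

Lemma tailE (Z : {RV P >-> nat}) x :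
  tail (natr_rv Z) x = pr P [set w | x < (Z w)%:R].
Proof.
rewrite /tail /ccdf /distribution /pushforward /pr; congr (fine (P _)).
by apply/seteqP; split=> w /=; rewrite in_itv/= andbT.
Qed.

Lemma measurable_natrv_gt (Z : {RV P >-> nat}) x :
  measurable [set w | x < (Z w)%:R :> R].
Proof. exact: (measurable_natrv Z [set v | x < v%:R]). Qed.

Lemma tail_nonincreasing (Z : {RV P >-> nat}) x y : x <= y ->
  tail (natr_rv Z) y <= tail (natr_rv Z) x.
Proof.
move=> xy; rewrite !tailE; apply: pr_mono => [||w /=].
- exact: measurable_natrv_gt.
- exact: measurable_natrv_gt.
- exact: le_lt_trans.
Qed.

(** The variable is integer-valued, so its tail only depends on the integer part
    of the level. *)
Lemma tail_truncn (Z : {RV P >-> nat}) x : 0 <= x ->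
  tail (natr_rv Z) (Num.truncn x)%:R = tail (natr_rv Z) x.
Proof.
move=> x0; rewrite !tailE; congr (pr P _); apply/seteqP; split=> w /=.
  by rewrite ltr_nat truncn_lt_nat.
by rewrite ltr_nat truncn_lt_nat.
Qed.

Context {I : choiceType} (Y : I -> {RV P >-> nat}) (D : set I) (k : nat -> I)
  (X xi eps S : {RV P >-> nat}) (r : R).

Hypothesis injk : injective k.
Hypothesis Dk : forall i, D (k i).
Hypothesis indepX : forall n, indep_event Y D (X @^-1` [set n]).
Hypothesis xiY : forall i, identically_distributed (Y (k i)) xi.
Hypothesis SE : forall w, S w = (\sum_(i < X w) Y (k i) w + eps w)%N.
Hypothesis r1 : 1 < r.
Hypothesis xir : ('E_P[(fun w => natr_rv xi w `^ r)%R] < +oo)%E.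

Let m := fine 'E_P[natr_rv xi].
Let M := fine 'E_P[(fun w => natr_rv xi w `^ r)%R].
Let s := Num.min r 2.

Let pr_xiY i A : pr P (Y (k i) @^-1` A) = pr P (xi @^-1` A).
Proof. by rewrite /pr; have := @xiY i A; rewrite /distribution/= /pushforward => ->. Qed.

Let mgf (sigma : R) (N : nat) := expR (sigma * m / (2 * N%:R) + M * N%:R `^ (- s)).

Let chernoff sigma N K B t : `|sigma| = 1 -> (0 < N)%N -> indep_event Y D B ->
  pr P (B `&` [set w | t <= \sum_(i < K) (sigma * (minn (Y (k i) w) N)%:R / (2 * N%:R))])
  <= pr P B * expR (- t) * mgf sigma N ^+ K.
Proof.
move=> sigma1 N0 iB.
apply: (@indep_sum_chernoff _ _ _ _ _ _
  (fun v => sigma * (minn v N)%:R / (2 * N%:R)) N (mgf sigma N) k K D B t) => //.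
- exact: expR_ge0.
- by move=> v; rewrite -minnA minnn.
- move=> i _; apply: le_trans (trunc_mgf_le r1 xir N0 sigma1).
  apply: ler_sum => v _; rewrite pr_xiY -/(trunc_pmf xi N v).
  by rewrite (minn_idPl _) // -ltnS.
Qed.

(** If S > x while X <= c * x and eps < delta * x, the sum of the Y_i, i < X, exceeds
    (1 - delta) * x. Either some Y_i exceeds N, and each pair of events i < X,
    Y_i > N is independent; or all Y_i equal their truncations, and the sum can be
    extended to i < truncn (c * x), which frees it from X. *)
Lemma compound_tail_le (c delta x : R) N : 0 < c -> 0 < delta -> 0 < x ->
  (0 < N)%N ->
  tail (natr_rv S) x <= tail (natr_rv X) (c * x) +
    pr P [set w | delta * x <= (eps w)%:R] +
    (\sum_(i < Num.truncn (c * x)) tail (natr_rv X) i%:R) * tail (natr_rv xi) N%:R +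
    expR (- ((1 - delta) * x / (2 * N%:R)) +
      c * x * (m / (2 * N%:R) + M * N%:R `^ (- s))).
Proof.
move=> c0 d0 x0 N0; have NR0 : 0 < N%:R :> R by rewrite ltr0n.
set K := Num.truncn _; have cx0 : 0 <= c * x by rewrite mulr_ge0// ltW.
have [Kle Klt] : K%:R <= c * x /\ c * x < K.+1%:R.
  by have /andP[] := truncn_itv cx0.
pose E1 := [set w | c * x < (X w)%:R].
pose E2 := [set w | delta * x <= (eps w)%:R].
pose F i := [set w | (i < X w)%N] `&` Y (k i) @^-1` [set v | (N < v)%N].
pose E3 := \big[setU/set0]_(i < K) F i.
pose t := (1 - delta) * x / (2 * N%:R).
pose E4 := setT `&` [set w | t <= \sum_(i < K) (1 * (minn (Y (k i) w) N)%:R / (2 * N%:R))].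
have mF i : measurable (F i).
  apply: measurableI; last exact: measurable_natrv.
  exact: (measurable_natrv X [set v | (i < v)%N]).
have mE1 : measurable E1 by exact: measurable_natrv_gt.
have mE2 : measurable E2 by exact: (measurable_natrv eps [set v | delta * x <= v%:R]).
have mE3 : measurable E3 by exact: bigsetU_measurable.
have mE4 : measurable E4.
  rewrite /E4 setTI.
  exact: (measurable_sum_ge _ (fun=> fun v => 1 * (minn v N)%:R / (2 * N%:R))
    (fun i => Y (k i))).
have sub : [set w | x < (S w)%:R] `<=` E1 `|` E2 `|` E3 `|` E4.
  move=> w /=; rewrite SE natrD => xS.
  have [e1|e1] := pselect (E1 w); first by left; left; left.
  have [e2|e2] := pselect (E2 w); first by left; left; right.
  have [e3|e3] := pselect (E3 w); first by left; right.
  right; split => //=.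
  have {}e1 : (X w)%:R <= c * x by rewrite leNgt; apply/negP.
  have {}e2 : (eps w)%:R < delta * x by rewrite ltNge; apply/negP.
  have XK : (X w <= K)%N by rewrite /K truncn_ge_nat.
  have YN i : (i < X w)%N -> (Y (k i) w <= N)%N.
    move=> iX; rewrite leqNgt; apply/negP => NY; apply: e3.
    by rewrite /E3 -bigcup_mkord; exists i => //=; exact: leq_trans XK.
  rewrite -mulr_suml /t ler_pM2r ?invr_gt0 ?mulr_gt0//.
  under eq_bigr do rewrite mul1r.
  rewrite -natr_sum; apply: (@le_trans _ _ (\sum_(i < X w) Y (k i) w)%N%:R).
    by apply: ltW; lra.
  rewrite ler_nat -!(big_mkord xpredT (fun i => Y (k i) w)).
  rewrite -!(big_mkord xpredT (fun i => minn (Y (k i) w) N)).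
  rewrite (big_cat_nat (leq0n _) XK)//= -[leqLHS]addn0; apply: leq_add => //.
  rewrite big_nat [leqRHS]big_nat; apply: leq_sum => i /andP[_ iX].
  by rewrite leq_min leqnn YN.
rewrite [leLHS]tailE; apply: (@le_trans _ _ (pr P (E1 `|` E2 `|` E3 `|` E4))).
  apply: pr_mono => //; first exact: measurable_natrv_gt.
  by repeat apply: measurableU => //.
apply: (le_trans (pr_setU2 _ _ _)) => //; first by repeat apply: measurableU => //.
apply: lerD.
  apply: (le_trans (pr_setU2 _ _ _)) => //; first by repeat apply: measurableU => //.
  apply: lerD.
    by apply: (le_trans (pr_setU2 _ _ _)) => //; rewrite [in leRHS]tailE.
  apply: (@le_trans _ _ (\sum_(i < K) pr P (F i))).
    apply: pr_subadditive => // w.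
    by rewrite /E3 -bigcup_mkord => -[i /= iK Fi]; exists i.
  rewrite mulr_suml; apply: ler_sum => i _.
  rewrite /F (pr_indepI _ (Dk i)); last first.
    exact: (indep_event_preimage [set v | (i < v)%N]).
  rewrite le_eqVlt; apply/orP; left; apply/eqP; rewrite pr_xiY !tailE.
  by congr (pr P _ * pr P _); apply/seteqP; split=> w /=; rewrite ltr_nat.
have iT : indep_event Y D setT by apply: (@indep_event_preimage _ _ _ _ _ _ X D setT).
apply: (le_trans (chernoff K t _ N0 iT)); first by rewrite normr1.
rewrite pr_setT mul1r /mgf mul1r -expRM_natl -expRD ler_expR lerD2l.
rewrite ler_wpM2r// addr_ge0 ?mulr_ge0 ?moment_ge0 ?powR_ge0 ?invr_ge0 ?mulr_ge0 ?(ltW NR0)//.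
by rewrite /m fine_ge0// expectation_ge0// => w; exact: ler0n.
Qed.

(** On X > c * x, the sum S has at least K.+1 > c * x terms; the Chernoff bound
    with a negative exponent says that the truncated terms alone add up to more
    than x, and applies on the event X > c * x itself. *)
Lemma compound_tail_ge (c x : R) N : 0 < c -> 0 < x -> (0 < N)%N ->
  M * N%:R `^ (- s) <= m / (2 * N%:R) ->
  tail (natr_rv X) (c * x) *
    (1 - expR (x / (2 * N%:R) + c * x * (M * N%:R `^ (- s) - m / (2 * N%:R))))
  <= tail (natr_rv S) x.
Proof.
move=> c0 x0 N0 hN; have NR0 : 0 < N%:R :> R by rewrite ltr0n.
set K := Num.truncn (c * x); have cx0 : 0 <= c * x by rewrite mulr_ge0// ltW.
have [Kle Klt] : K%:R <= c * x /\ c * x < K.+1%:R.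
  by have /andP[] := truncn_itv cx0.
pose B := [set w | c * x < (X w)%:R].
pose t := - (x / (2 * N%:R)).
pose E := [set w | t <= \sum_(i < K.+1) (- 1 * (minn (Y (k i) w) N)%:R / (2 * N%:R))].
have mB : measurable B by exact: measurable_natrv_gt.
have mE : measurable E.
  exact: (measurable_sum_ge _ (fun=> fun v => - 1 * (minn v N)%:R / (2 * N%:R))
    (fun i => Y (k i))).
have iB : indep_event Y D B by exact: (indep_event_preimage [set v | c * x < v%:R]).
have sub : B `<=` (B `&` E) `|` [set w | x < (S w)%:R].
  move=> w Bw; have [Ew|Ew] := pselect (E w); [by left|right => /=].
  have {}Ew : \sum_(i < K.+1) (- 1 * (minn (Y (k i) w) N)%:R / (2 * N%:R)) < t.
    by rewrite ltNge; apply/negP.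
  have KX : (K.+1 <= X w)%N.
    by rewrite -(ltr_nat R) (le_lt_trans Kle).
  move: Ew; rewrite -mulr_suml /t -mulNr ltr_pM2r ?invr_gt0 ?mulr_gt0//.
  under eq_bigr do rewrite mulN1r.
  rewrite sumrN ltrN2 -natr_sum => /lt_le_trans; apply.
  rewrite SE ler_nat -!(big_mkord xpredT (fun i => Y (k i) w)).
  rewrite -!(big_mkord xpredT (fun i => minn (Y (k i) w) N)).
  rewrite (big_cat_nat (leq0n _) KX)//= -addnA.
  apply: (@leq_trans (\sum_(0 <= i < K.+1) Y (k i) w)%N); last exact: leq_addr.
  by apply: leq_sum => i _; exact: geq_minl.
have : pr P B <= pr P (B `&` E) + tail (natr_rv S) x.
  rewrite tailE; apply: (le_trans _ (pr_setU2 _ _ _)) => //.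
  - apply: pr_mono => //; apply: measurableU; first exact: measurableI.
    exact: measurable_natrv_gt.
  - exact: measurableI.
  - exact: measurable_natrv_gt.
have : pr P (B `&` E) <= pr P B *
    expR (x / (2 * N%:R) + c * x * (M * N%:R `^ (- s) - m / (2 * N%:R))).
  apply: (le_trans (chernoff K.+1 t _ N0 iB)); first by rewrite normrN1.
  rewrite -mulrA; apply: ler_wpM2l; first exact: pr_ge0.
  rewrite /mgf mulN1r -expRM_natl -expRD ler_expR opprK lerD2l mulNr addrC.
  apply: ler_wnM2r; first by rewrite subr_le0.
  exact: ltW.
move=> h1 h2; rewrite [X in X * _]tailE -/B [leLHS]mulrBr mulr1; lra.
Qed.

End compound.

Section compound_asymptotics.
Context {d : measure_display} {T : measurableType d} {R : realType}
  {P : probability T R}.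

(** Each cause of S > x other than X > c * x carries a factor tending to 0
    relative to W = C (c x)^q P(X > c x), which bounds both 1 and the sum of the
    P(X > i) for i < c x; for these factors to compensate x^q, the exponents are chosen such that
    max(1, beta) < q < theta r and theta < 1. *)
Lemma compound_tail_equiv {I : choiceType} (Y : I -> {RV P >-> nat})
    (D : set I) (k : nat -> I) (X xi eps S : {RV P >-> nat}) (beta r : R) :
  injective k -> (forall i, D (k i)) ->
  (forall n, indep_event Y D (X @^-1` [set n])) ->
  (forall i, identically_distributed (Y (k i)) xi) ->
  (forall w, S w = (\sum_(i < X w) Y (k i) w + eps w)%N) ->
  1 < r -> beta < r ->
  ('E_P[(fun w => natr_rv xi w `^ r)%R] < +oo)%E ->
  ('E_P[(fun w => natr_rv eps w `^ r)%R] < +oo)%E ->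
  0 < fine 'E_P[natr_rv xi] ->
  regularly_varying (natr_rv X) beta ->
  tail (natr_rv S) x / tail (natr_rv X) x @[x --> +oo] -->
    fine 'E_P[natr_rv xi] `^ beta.
Proof.
move=> injk Dk indepX xiY SE r1 br xir epsr m0 [_ Xpos Xrv].
set m := fine _ in m0 *.
pose M := fine 'E_P[(fun w => natr_rv xi w `^ r)%R].
pose Me := fine 'E_P[(fun w => natr_rv eps w `^ r)%R].
pose s := Num.min r 2.
have M0 : 0 <= M by exact: moment_ge0.
have Me0 : 0 <= Me by exact: moment_ge0.
have s1 : 1 < s by rewrite lt_min r1/=; lra.
have powNs (y : R) : 0 < y -> y `^ (- s) = y `^ (- (s - 1)) / y.
  move=> y0; rewrite -[X in _ / X]powRr1 ?(ltW y0)// -powRN -powRD.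
    by congr (_ `^ _); lra.
  by rewrite lt0r_neq0 ?implybT.
apply: (@regular_variation_ratio_cvg _ (tail (natr_rv X)) (tail (natr_rv S)) beta m) => // c c0.
- move=> cm.
  have [q [q1 bq qr]] : exists q, [/\ 1 < q, beta < q & q < r].
    have : 1 <= Num.max 1 beta by rewrite le_max lexx.
    have : beta <= Num.max 1 beta by rewrite le_max lexx orbT.
    have : Num.max 1 beta < r by rewrite gt_max r1.
    by exists ((Num.max 1 beta + r) / 2); split; lra.
  have [C C0 hC] := regular_variation_sum_le (@tail_nonincreasing _ _ _ _ X) Xpos Xrv q1 bq.
  have [theta [th0 th1 thr]] : exists t, [/\ 0 < t, t < 1 & q < t * r].
    have r0 : 0 < r by lra.
    have qr1 : q / r < 1 by rewrite ltr_pdivrMr// mul1r.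
    have qr0 : 0 < q / r by rewrite divr_gt0//; lra.
    exists ((q / r + 1) / 2); split; [lra|lra|].
    by rewrite -ltr_pdivrMr//; lra.
  (* so that 1 - delta - c m = 2 delta: the sum must exceed its mean by
     2 delta x *)
  pose delta := (1 - c * m) / 3.
  have d0 : 0 < delta by rewrite /delta; lra.
  pose N x := Num.truncn (x `^ theta).
  exists (fun x => C * c `^ q * (Me * delta `^ (- r) * x `^ (- (r - q)) +
    (M * x `^ (- (theta * r - q)) +
     x `^ q * expR (- (delta / 2 * x `^ (1 - theta)))))).
    rewrite -[X in _ --> X](mulr0 (C * c `^ q)); apply: cvgMr.
    rewrite -[X in _ --> X](addr0 0); apply: cvgD.
      rewrite -[X in _ --> X](mulr0 (Me * delta `^ (- r))); apply: cvgMr.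
      by apply: cvg_powR_0; rewrite subr_gt0.
    rewrite -[X in _ --> X](addr0 0); apply: cvgD.
      rewrite -[X in _ --> X](mulr0 M); apply: cvgMr.
      by apply: cvg_powR_0; rewrite subr_gt0.
    by apply: cvg_powR_expR; lra.
  have hN : \forall x \near +oo, c * M * (N x)%:R `^ (- (s - 1)) < delta / 2.
    have h : c * M * y `^ (- (s - 1)) @[y --> +oo] --> (0 : R).
      rewrite -[X in _ --> X](mulr0 (c * M)); apply: cvgMr.
      by apply: cvg_powR_0; rewrite subr_gt0.
    apply: (cvgr_lt _ (cvg_comp _ _ (cvg_truncn_powR_y th0) h)); lra.
  near=> x.
  have x0 : 0 < x by [].
  have x1 : 1 <= x by near: x; apply: nbhs_pinfty_ge; exact: num_real.
  have cx0 : 0 < c * x by exact: mulr_gt0.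
  have K1 : (0 < Num.truncn (c * x))%N.
    rewrite truncn_gt0 mulrC -ler_pdivrMr//; near: x; apply: nbhs_pinfty_ge; exact: num_real.
  have N1 : (0 < N x)%N.
    by rewrite truncn_gt0 -(powRr0 x); apply: ler_powR => //; exact: ltW.
  have NR0 : 0 < (N x)%:R :> R by rewrite ltr0n.
  have NX : (N x)%:R <= x `^ theta by rewrite truncn_le powR_ge0.
  apply: (le_trans (compound_tail_le injk Dk indepX xiY SE r1 xir c0 d0 x0 N1)).
  rewrite -/m -/M -/s.
  set FX := tail (natr_rv X) (c * x).
  have FX0 : 0 < FX by exact: Xpos.
  have {}hC : 1 + \sum_(i < Num.truncn (c * x)) tail (natr_rv X) i%:R <=
      C * c `^ q * x `^ q * FX.
    apply: (le_trans (hC _ K1)); rewrite tail_truncn ?(ltW cx0)// -/FX.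
    rewrite -(mulrA C (c `^ q)) -powRM ?(ltW c0) ?(ltW x0)//.
    rewrite ler_pM2r// ler_pM2l//; apply: ge0_ler_powR; rewrite ?nnegrE ?(ltW cx0)//.
      by lra.
    by rewrite truncn_le ltW.
  set G := \sum_(i < _) _ in hC *.
  have G0 : 0 <= G by apply: sumr_ge0 => i _; rewrite tailE pr_ge0.
  set W := C * c `^ q * x `^ q * FX in hC.
  have W0 : 0 <= W by lra.
  have t1 : pr P [set w | delta * x <= (eps w)%:R] <=
      W * (Me * delta `^ (- r) * x `^ (- r)).
    apply: (@le_trans _ _ (Me * delta `^ (- r) * x `^ (- r))).
      rewrite -mulrA -powRM ?(ltW d0) ?(ltW x0)//.
      by apply: moment_tail => //; exact: mulr_gt0.
    by rewrite ler_peMl// ?mulr_ge0 ?powR_ge0//; lra.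
  have t2 : G * tail (natr_rv xi) (N x)%:R <= W * (M * x `^ (- (theta * r))).
    apply: ler_pM => //; first by rewrite tailE pr_ge0.
      by lra.
    rewrite /N tail_truncn ?powR_ge0// tailE.
    rewrite -mulrN powRrM; apply: (le_trans _ (moment_tail r1 xir (powR_gt0 _ x0))).
    apply: pr_mono => [||w /= /ltW//].
      exact: measurable_natrv_gt.
    exact: (measurable_natrv xi [set v | x `^ theta <= v%:R]).
  have t3 : expR (- ((1 - delta) * x / (2 * (N x)%:R)) +
      c * x * (m / (2 * (N x)%:R) + M * (N x)%:R `^ (- s))) <=
      W * expR (- (delta / 2 * x `^ (1 - theta))).
    apply: (@le_trans _ _ (expR (- (delta / 2 * x `^ (1 - theta))))); last first.
      by rewrite ler_peMl ?expR_ge0//; lra.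
    rewrite ler_expR powNs//.
    have hNx : c * M * (N x)%:R `^ (- (s - 1)) < delta / 2 by near: x.
    set u := (N x)%:R `^ (- (s - 1)) in hNx *.
    rewrite (_ : _ + _ = - ((delta - c * M * u) * (x / (N x)%:R))); last first.
      by rewrite /delta; field; apply: lt0r_neq0.
    rewrite lerN2; apply: ler_pM; rewrite ?powR_ge0//; [lra|lra|].
    rewrite ler_pdivlMr// powRB ?(lt0r_neq0 x0) ?implybT// powRr1 ?(ltW x0)//.
    by rewrite mulrAC ler_pdivrMr ?powR_gt0// ler_pM2l.
  apply: (@le_trans _ _ (FX + W * (Me * delta `^ (- r) * x `^ (- r)) +
    W * (M * x `^ (- (theta * r))) + W * expR (- (delta / 2 * x `^ (1 - theta))))).
    by lra.
  have e1 (a : R) : x `^ (- (a - q)) = x `^ q * x `^ (- a).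
    by rewrite -powRD ?(lt0r_neq0 x0) ?implybT//; congr (_ `^ _); lra.
  rewrite !e1 le_eqVlt; apply/orP; left; apply/eqP; rewrite /W; ring.
- move=> cm.
  have hN : \forall y \near +oo, 2 * M * y `^ (- (s - 1)) < m - c^-1.
    have h : 2 * M * y `^ (- (s - 1)) @[y --> +oo] --> (0 : R).
      rewrite -[X in _ --> X](mulr0 (2 * M)); apply: cvgMr.
      by apply: cvg_powR_0; rewrite subr_gt0.
    by apply: (cvgr_lt _ h); rewrite subr_gt0 -div1r ltr_pdivrMr// mulrC.
  (* a fixed truncation level, for which the truncated mean still exceeds 1 / c *)
  have [B [_ hB]] := hN.
  pose N := (Num.truncn `|B|).+1.
  have /hB {}hB : B < N%:R by apply: (le_lt_trans (ler_norm B)); exact: truncnS_gt.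
  have NR0 : 0 < N%:R :> R by rewrite ltr0n.
  set u := N%:R `^ (- (s - 1)) in hB.
  pose kappa := (c * (m - 2 * M * u) - 1) / (2 * N%:R).
  have kappa0 : 0 < kappa.
    rewrite divr_gt0 ?mulr_gt0// subr_gt0 mulrC -ltr_pdivrMr// div1r.
    by move: hB; rewrite /=; lra.
  exists (fun x => expR (- (kappa * x))).
    have h := cvg_comp (fun x => kappa * x) (fun y => expR (- y))
      (cvg_mul_y kappa0) (@cvgr_expR R).
    exact: h.
  near=> x.
  have x0 : 0 < x by [].
  have hMN : M * N%:R `^ (- s) <= m / (2 * N%:R).
    rewrite powNs// -/u mulrA invfM mulrA ler_pM2r ?invr_gt0//.
    have : 0 < c^-1 by rewrite invr_gt0.
    by move: hB; rewrite /=; lra.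
  have := compound_tail_ge injk Dk indepX xiY SE r1 xir c0 x0
    (isT : (0 < N)%N) hMN.
  rewrite -/m -/M -/s powNs// -/u.
  rewrite (_ : x / _ + _ = - (kappa * x))//.
  by rewrite /kappa; field; apply: lt0r_neq0.
Unshelve. all: by end_near. Qed.

End compound_asymptotics.

(** * Galton-Watson processes with immigration *)

Section regularly_varying_equiv.
Context {d : measure_display} {T : measurableType d} {R : realType}
  {P : probability T R}.

Lemma regularly_varying_equiv (X Z : {RV P >-> nat}) (beta l : R) :
  0 < l -> regularly_varying (natr_rv X) beta ->
  tail (natr_rv Z) x / tail (natr_rv X) x @[x --> +oo] --> l ->
  regularly_varying (natr_rv Z) beta.
Proof.
move=> l0 [_ Xpos Xrv] ZX.
have Zpos x : 0 < x -> 0 < tail (natr_rv Z) x.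
  move=> x0; have h := cvgr_gt _ ZX _ l0.
  near (pinfty_nbhs R) => y.
  have xy : x <= y by near: y; apply: nbhs_pinfty_ge; exact: num_real.
  apply: (lt_le_trans _ (tail_nonincreasing Z xy)).
  have : 0 < tail (natr_rv Z) y / tail (natr_rv X) y by near: y; exact: h.
  by rewrite pmulr_lgt0// invr_gt0 Xpos// (lt_le_trans x0).
split=> // q q0.
have qy : q * x @[x --> +oo] --> +oo by apply: gt0_cvgMry => //; exact: cvg_id.
have ZXq := cvg_comp (fun x => q * x)
  (fun y => tail (natr_rv Z) y / tail (natr_rv X) y) qy ZX.
have XZ : (tail (natr_rv Z) x / tail (natr_rv X) x)^-1 @[x --> +oo] --> l^-1.
  by apply: cvgV ZX; exact: lt0r_neq0.
have : (tail (natr_rv Z) (q * x) / tail (natr_rv X) (q * x)) *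
    (tail (natr_rv X) (q * x) / tail (natr_rv X) x) *
    (tail (natr_rv Z) x / tail (natr_rv X) x)^-1 @[x --> +oo] --> q `^ (- beta).
  rewrite -[X in _ --> X](mulfK (lt0r_neq0 l0)) [X in X / _]mulrC.
  by apply: cvgM XZ; apply: cvgM (Xrv q q0); exact: ZXq.
move=> h; apply: cvg_trans h; apply: near_eq_cvg; near=> x => /=.
have x0 : 0 < x by [].
rewrite /= invf_div; field.
by rewrite !lt0r_neq0 ?Xpos ?Zpos// mulr_gt0.
Unshelve. all: by end_near. Qed.

End regularly_varying_equiv.

Section galton_watson_independence.
Context {d : measure_display} {T : measurableType d} {R : realType}
  {P : probability T R}.

(** The family [gwi_family] is indexed from 0: index n holds the variables that
    produce generation n.+1 from generation n. *)
Definition after_generation n : set gwi_index := fun k =>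
  match k with
  | inl _ => False
  | inr (inl (l, _)) => (n <= l)%N
  | inr (inr l) => (n <= l)%N
  end.

Lemma gwi_recE X xi eps : @galton_watson_immigration _ _ _ P X xi eps ->
  forall n w, X n.+1 w = (\sum_(i < X n w)
    gwi_family (X 0%N) xi eps (inr (inl (n, i : nat))) w +
    gwi_family (X 0%N) xi eps (inr (inr n)) w)%N.
Proof. by move=> gw n w; rewrite (gwi_rec gw)//= big_add1 big_mkord. Qed.

(** The current generation is a function of X_0 and of the variables of the
    previous generations only. *)
Lemma gwi_indep_future X xi eps : @galton_watson_immigration _ _ _ P X xi eps ->
  forall n j, indep_event (gwi_family (X 0%N) xi eps) (after_generation n)
    (X n @^-1` [set j]).
Proof.
move=> gw; elim=> [|n IHn] j.
  have := indep_eventI [set j] (I : setT (inl tt)) (indep_eventT setT (gwi_indep gw)).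
  move=> [_]; rewrite setTI; apply: indep_event_sub.
  by move=> i i0; split=> //= ii; rewrite ii in i0.
apply: (indep_event_compound (k := fun i => inr (inl (n, i))) (e := inr (inr n))
  _ _ _ _ _ IHn) => //=.
- by move=> a b [].
- by move=> [//|[[l i]|l]] /=; exact: ltnW.
- by move=> i; split=> //=; rewrite ltnn.
- by rewrite ltnn.
- exact: gwi_recE.
Qed.

End galton_watson_independence.

Theorem proposition2p2 (d : measure_display) (T : measurableType d)
  (R : realType) (P : probability T R)
  (X : nat -> {RV P >-> nat}) (xi : nat -> nat -> {RV P >-> nat})
  (eps : nat -> {RV P >-> nat}) (beta : R)
  (hgwi : galton_watson_immigration X xi eps)
  (hbeta : 0 <= beta)
  (hX0 : regularly_varying (natr_rv (X 0%N)) beta)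
  (hxi0 : (P (xi 1%N 1%N @^-1` [set 0%N]) < 1)%E)
  (hmom : exists r : R,
    [/\ Num.max 1 beta < r,
        ('E_P[(fun w => natr_rv (xi 1%N 1%N) w `^ r)%R] < +oo)%E
      & ('E_P[(fun w => natr_rv (eps 1%N) w `^ r)%R] < +oo)%E]) :
  forall n : nat, (1 <= n)%N ->
    asymp_equiv (tail (natr_rv (X n)))
      (fun x => fine 'E_P[natr_rv (xi 1%N 1%N)] `^ (n%:R * beta)
                * tail (natr_rv (X 0%N)) x)
    /\ regularly_varying (natr_rv (X n)) beta.
Proof.
case: hmom => r [+ xir epsr]; rewrite gt_max => /andP[r1 br].
have m0 := mean_gt0 r1 xir hxi0; set m := fine _ in m0 *.
have epsr' n : ('E_P[(fun w => natr_rv (eps n.+1) w `^ r)%R] < +oo)%E.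
  by rewrite (identically_distributed_moment r (gwi_eps_id hgwi _)).
have main n : tail (natr_rv (X n)) x / tail (natr_rv (X 0%N)) x @[x --> +oo] -->
      m `^ (n%:R * beta) /\ regularly_varying (natr_rv (X n)) beta.
  elim: n => [|n [IHc IHrv]].
    split=> //; rewrite mul0r powRr0; apply: cvg_near_cst; near=> x.
    by rewrite divff// lt0r_neq0//; case: hX0 => _ + _; apply.
  have step : tail (natr_rv (X n.+1)) x / tail (natr_rv (X n)) x @[x --> +oo] --> m `^ beta.
    apply: (compound_tail_equiv (k := fun i => inr (inl (n, i)))
      (D := after_generation n) (eps := eps n.+1) (S := X n.+1)
      _ _ (gwi_indep_future hgwi n) _ _ r1 br xir (epsr' n) m0 IHrv).
    - by move=> a b [].
    - by move=> i; exact: leqnn.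
    - by move=> i; exact: (gwi_xi_id hgwi).
    - exact: (gwi_recE hgwi).
  split; last by apply: regularly_varying_equiv IHrv step; exact: powR_gt0.
  have : (tail (natr_rv (X n.+1)) x / tail (natr_rv (X n)) x) *
      (tail (natr_rv (X n)) x / tail (natr_rv (X 0%N)) x) @[x --> +oo] -->
      m `^ (n.+1%:R * beta).
    rewrite -nat1r mulrDl mul1r powRD; last by rewrite lt0r_neq0 ?implybT.
    exact: cvgM.
  move=> h; apply: cvg_trans h; apply: near_eq_cvg; near=> x => /=.
  have x0 : 0 < x by [].
  rewrite mulrA divfK// lt0r_neq0//; by case: IHrv => _ + _; apply.
move=> n _; have [hc hrv] := main n; split=> //.
have mn0 : m `^ (n%:R * beta) != 0 by rewrite lt0r_neq0// powR_gt0.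
have : tail (natr_rv (X n)) x / tail (natr_rv (X 0%N)) x /
    m `^ (n%:R * beta) @[x --> +oo] --> (1 : R).
  by rewrite -[X in _ --> X](mulfV mn0); exact: cvgMl.
move=> h; rewrite /asymp_equiv; under eq_fun do rewrite invfM mulrCA mulrC.
exact: h.
Unshelve. all: by end_near. Qed.
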